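(* If $D$ is a generalized skew diagram, then $\mathrm{MaxG}(D)=\mathrm{sf}(D)$.
   Context: A diagram is a finite set of cells at positions $(r,c)$ with $r,c$ positive integers ($r$ = row from the bottom, $c$ = column), at most one cell per position; each cell is either ordinary, written $(r,c)$, or a ghost cell, written $\langle r,c\rangle$. A position is empty if it contains no cell. K-Kohnert move at row $r$ of $D$: let the rightmost cell of row $r$ (ghost or not) lie in column $c$. The move does nothing if that cell is a ghost cell, or every position $(r',c)$ with $r'<r$ is occupied, or, letting $\hat r<r$ be maximal with $(\hat r,c)$ empty, some $(r^*,c)$ with $\hat r<r^*<r$ holds a ghost cell. Otherwise there are two choices: the Kohnert move moves the cell from $(r,c)$ to $(\hat r,c)$; the ghost move does the same and additionally places a ghost cell $\langle r,c\rangle$ at $(r,c)$. $KKD(D)$ is the set of $D$ and all diagrams obtained from $D$ by finite sequences of K-Kohnert moves; $\mathrm{MaxG}(D)$ is the maximum number of ghost cells in a diagram of $KKD(D)$. Snow diagram: for $D$ with no ghost cells, process rows from top to bottom; in each row mark the rightmost cell of that row with no already-marked cell above it in its column (if any); marked cells are dark clouds. Place a snowflake in each empty position strictly below a dark cloud in the same column; $\mathrm{sf}(D)$ is the number of snowflakes. Generalized skew diagram: a diagram $D$ with no ghost cells whose nonempty rows are $r_1<\dots<r_n$, such that, writing $c_i^+$ (resp. $c_i^-$) for the column of the rightmost (resp. leftmost) cell of row $r_i$: for each $i$, $(r_i,\tilde c)\in D$ for all $c_i^-<\tilde c<c_i^+$; and $c_i^+\le c_j^+$, $c_i^-\le c_j^-$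 whenever $i<j$. *)

(* Defs.v *)
From mathcomp Require Import all_boot finmap.
From Stdlib Require Import Relation_Operators.

Set Implicit Arguments.
Unset Strict Implicit.
Unset Printing Implicit Defensive.

Local Open Scope fset_scope.
Local Open Scope fmap_scope.
Local Open Scope nat_scope.

Inductive cell := Ordinary | Ghost.

(* A position is a pair (row, column), with rows numbered from the bottom. The
   type does not enforce positivity of rows and columns: see [is_diagram]. *)
Definition diagram : Type := {fmap nat * nat -> cell}.

Definition is_diagram (D : diagram) : Prop :=
  forall p : nat * nat, p \in D -> (0 < p.1) && (0 < p.2).

Definition is_ghost (D : diagram) (p : nat * nat) : bool :=
  if D.[? p] is Some Ghost then true else false.

Definition ghost_free (D : diagram) : Prop :=
  forall p : nat * nat, ~~ is_ghost D p.

Definition num_ghosts (D : diagram) : nat :=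
  #|` [fset p in domf D | is_ghost D p]|.

Definition rightmost (D : diagram) (r c : nat) : Prop :=
  (r, c) \in D /\ forall c' : nat, (r, c') \in D -> c' <= c.

Definition leftmost (D : diagram) (r c : nat) : Prop :=
  (r, c) \in D /\ forall c' : nat, (r, c') \in D -> c <= c'.

(* The row [r0] is the largest r' with 0 < r' < r and (r', c) empty. *)
Definition landing_row (D : diagram) (r c r0 : nat) : Prop :=
  [/\ 0 < r0 < r, (r0, c) \notin D &
      forall r' : nat, 0 < r' < r -> (r', c) \notin D -> r' <= r0].

(* A K-Kohnert move at row [r] of [D] does something: it moves the cell at
   (r, c) to (r0, c). *)
Definition can_move (D : diagram) (r c r0 : nat) : Prop :=
  [/\ rightmost D r c, ~~ is_ghost D (r, c), landing_row D r c r0 &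
      forall r' : nat, r0 < r' < r -> ~~ is_ghost D (r', c)].

(* Moves that leave the diagram unchanged are omitted; they do not affect the
   reflexive closure [KKD]. *)
Inductive kkohnert_move (D : diagram) : diagram -> Prop :=
| Kohnert_move (r c r0 : nat) : can_move D r c r0 ->
    kkohnert_move D (D.[~ (r, c)]).[(r0, c) <- Ordinary]
| Ghost_move (r c r0 : nat) : can_move D r c r0 ->
    kkohnert_move D (D.[(r, c) <- Ghost]).[(r0, c) <- Ordinary].

Definition KKD (D T : diagram) : Prop :=
  clos_refl_trans diagram kkohnert_move D T.

Definition is_MaxG (D : diagram) (m : nat) : Prop :=
  (exists2 T : diagram, KKD D T & num_ghosts T = m) /\
  (forall T : diagram, KKD D T -> num_ghosts T <= m).

Definition top_row (D : diagram) : nat := \max_(p <- domf D) p.1.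

Definition markable (D : diagram) (r : nat) (M : {fset nat * nat}) :
    {fset nat * nat} :=
  [fset p in domf D |
     (p.1 == r) && ~~ has (fun q : nat * nat => (q.2 == p.2) && (p.1 < q.1)) M].

Definition mark_row (D : diagram) (r : nat) (M : {fset nat * nat}) :
    {fset nat * nat} :=
  if markable D r M == fset0 then M
  else (r, \max_(p <- markable D r M) p.2) |` M.

(* [foldr] on the increasing list of rows handles the top row first. *)
Definition dark_clouds (D : diagram) : {fset nat * nat} :=
  foldr (mark_row D) fset0 (iota 1 (top_row D)).

(* For a dark cloud p, the list [iota 1 p.1.-1] consists of the r with
   0 < r < p.1. *)
Definition snowflakes (D : diagram) : {fset nat * nat} :=
  [fset q in [seq (r, p.2) | p <- dark_clouds D, r <- iota 1 p.1.-1] |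
     q \notin domf D].

Definition sf (D : diagram) : nat := #|` snowflakes D|.

(* The statement for the rows r < s, both nonempty, is the statement for the
   indices i < j in the enumeration of the nonempty rows. *)
Definition generalized_skew (D : diagram) : Prop :=
  [/\ is_diagram D, ghost_free D,
      (forall r a b c : nat, leftmost D r a -> rightmost D r b ->
         a < c < b -> (r, c) \in D),
      (forall r s a b : nat, r < s -> rightmost D r a -> rightmost D s b ->
         a <= b) &
      (forall r s a b : nat, r < s -> leftmost D r a -> leftmost D s b ->
         a <= b)].

(* Main.v *)
Require Import Defs.
From mathcomp Require Import all_boot finmap.
From mathcomp Require Import zify.
From Stdlib Require Import Relation_Operators.

Set Implicit Arguments.
Unset Strict Implicit.
Unset Printing Implicit Defensive.

Local Open Scope fset_scope.
Local Open Scope fmap_scope.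
Local Open Scope nat_scope.

(* Upper bound. Ghost cells are never moved or jumped over, so the k-th lowest
   ordinary cell of a column can be identified, at any time, with the k-th
   lowest cell of that column of D. A ghost cell at (r, c) is charged to the
   cell of D just below it in this sense, in the j-th nonempty row say, and is
   given the level r - j. Two ghost cells of the same level lie in different
   columns (clear) and are charged to different rows (a cell moves only when
   nothing is to its right), so the cells charged at one level form a partial
   matching of rows and columns; moreover these rows are above, or these columns
   right of, a bound that depends on the level. The dark clouds are a greedy
   matching, and an exchange argument shows that it is maximum in every such
   region. Summing over the levels, each dark cloud is counted at most once for
   each snowflake below it.

   Lower bound. Treat the rows from bottom to top, and each row from right to
   left: a cell with a dark cloud above it sinks to the bottom by Kohnert moves,
   a dark cloud goes down by ghost moves, one row at a time, and the other cells
   stay. A dark cloud then leaves as many ghost cells as it has snowflakes. *)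

(** * Ordinary cells and their number in the lower part of a column *)

Definition is_ord (T : diagram) (p : nat * nat) : bool :=
  if T.[? p] is Some Ordinary then true else false.

Lemma mem_ord_ghost (T : diagram) p : (p \in T) = is_ord T p || is_ghost T p.
Proof. by rewrite -fndSome /is_ord /is_ghost; case: T.[? p] => [[]|]. Qed.

Lemma ord_not_ghost (T : diagram) p : is_ord T p -> ~~ is_ghost T p.
Proof. by rewrite /is_ord /is_ghost; case: T.[? p] => [[]|]. Qed.

Definition col_ords (T : diagram) (c s : nat) : nat :=
  \sum_(1 <= r < s.+1) is_ord T (r, c).

Lemma col_ords0 T c : col_ords T c 0 = 0.
Proof. by rewrite /col_ords big_geq. Qed.

Lemma col_ordsS T c s :
  col_ords T c s.+1 = col_ords T c s + is_ord T (s.+1, c).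
Proof. by rewrite /col_ords big_nat_recr. Qed.

Lemma col_ords_le T c s k :
  col_ords T c s <= col_ords T c (s + k) <= col_ords T c s + k.
Proof.
elim: k => [|k IHk]; first by rewrite !addn0 leqnn.
by rewrite addnS col_ordsS; case: is_ord => /=; lia.
Qed.

Lemma col_ords_bounds T c s s' : s <= s' ->
  col_ords T c s <= col_ords T c s' <= col_ords T c s + (s' - s).
Proof.
by move=> le_ss'; have := col_ords_le T c s (s' - s); rewrite subnKC.
Qed.

Lemma col_ords_full T c s k :
  (forall r, s < r <= s + k -> is_ord T (r, c)) ->
  col_ords T c (s + k) = col_ords T c s + k.
Proof.
elim: k => [|k IHk] full; first by rewrite !addn0.
rewrite addnS col_ordsS IHk => [|r lt_r]; last by apply: full; lia.
by rewrite full /=; lia.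
Qed.

(* [g] is the content left at (r, c): nothing or a ghost. *)
Definition moved (T : diagram) (r c r0 : nat) (g : option cell) (T' : diagram) :=
  forall p, T'.[? p] = if p == (r0, c) then Some Ordinary
                       else if p == (r, c) then g else T.[? p].

Lemma kkohnert_moved T T' : kkohnert_move T T' ->
  exists r c r0 g, [/\ can_move T r c r0, moved T r c r0 g T' &
                       g = None \/ g = Some Ghost].
Proof.
case=> r c r0 cm.
- exists r, c, r0, None; split=> //; last by left.
  move=> p; rewrite fnd_set fnd_rem1.
  by case: (p == (r0, c)) => //; case: (p == (r, c)).
- exists r, c, r0, (Some Ghost); split=> //; last by right.
  by move=> p; rewrite !fnd_set.
Qed.

(** * Effect of a single move *)

Section Move.
Variables (T T' : diagram) (r c r0 : nat) (g : option cell).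
Hypotheses (cm : can_move T r c r0) (mv : moved T r c r0 g T').
Hypothesis gP : g = None \/ g = Some Ghost.

Lemma move_rows : 0 < r0 < r.
Proof. by case: cm => _ _ []. Qed.

Lemma move_right c' : c < c' -> (r, c') \notin T.
Proof.
move=> lt_c; apply/negP; case: cm => -[_ h] _ _ _ /h; lia.
Qed.

(** The landing row is the highest empty position below row [r], and [can_move] excludes ghost cells
    between the two, so only ordinary cells are jumped over. *)
Lemma move_block q : r0 < q <= r -> is_ord T (q, c).
Proof.
case: cm => -[inT _] ngh [_ _ land] nogh /andP[lt_r0q].
rewrite leq_eqVlt => /orP[/eqP->|lt_qr].
  by move: inT; rewrite mem_ord_ghost (negPf ngh) orbF.
have : (q, c) \in T by apply/negPn/negP=> /land; lia.
by rewrite mem_ord_ghost (negPf (nogh q _)) ?orbF ?lt_r0q.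
Qed.

Lemma move_no_ghost q : is_ghost T (q, c) -> q < r0 \/ r < q.
Proof.
move=> gh; case: (ltngtP q r0) => [|lt_r0q|eq_q]; first by left.
- case: (ltnP r q) => [|le_qr]; first by right.
  by have := ord_not_ghost (@move_block q _); rewrite gh lt_r0q le_qr => /(_ isT).
- case: cm => _ _ [_] + _ _; rewrite mem_ord_ghost -eq_q gh; lia.
Qed.

Lemma moved_ord p :
  is_ord T' p = (p == (r0, c)) || (p != (r, c)) && is_ord T p.
Proof.
rewrite /is_ord mv; case: eqP => // _; case: eqP => // _.
by case: gP => ->.
Qed.

Lemma moved_ghost p : is_ghost T' p -> is_ghost T p \/ p = (r, c).
Proof.
rewrite /is_ghost mv; case: eqP => // _; case: eqP => [|_]; first by right.
by left.
Qed.

Lemma moved_col_ords_other c' s : c' != c -> col_ords T' c' s = col_ords T c' s.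
Proof.
move=> ne_c; apply: eq_bigr => q _; rewrite moved_ord /=.
by rewrite !xpair_eqE (negPf ne_c) !andbF.
Qed.

Lemma moved_col_ords s :
  col_ords T' c s = col_ords T c s + (r0 <= s < r).
Proof.
have /andP[r0_gt0 lt_r0r] := move_rows.
elim: s => [|s IHs]; first by rewrite !col_ords0; lia.
rewrite !col_ordsS IHs moved_ord !xpair_eqE !eqxx !andbT.
have := @move_block s.+1.
have : s.+1 = r0 -> is_ord T (s.+1, c) = false.
  move=> ->; case: cm => _ _ [_ + _ _].
  by rewrite mem_ord_ghost negb_or => /andP[/negPf].
case: (ltngtP s.+1 r0); case: (ltngtP s.+1 r) => /=; case: is_ord => //=; lia.
Qed.

Lemma col_ords_block s : r0 <= s <= r ->
  col_ords T c r = col_ords T c s + (r - s).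
Proof.
move=> /andP[le_r0s le_sr]; rewrite -{1}(subnKC le_sr).
by apply: col_ords_full => q hq; apply: move_block; lia.
Qed.

End Move.

(** * An invariant of all moves *)

Section Invariant.
Variables (D : diagram) (beta : nat -> nat).

(* For [beta := rows_left], defined below, [bcount T c r.-1] is the index of the
   row of D to which a ghost cell of T at (r, c) is charged. *)
Definition bcount (T : diagram) c s := beta c + col_ords T c s.

(** Cells only sink, hence [inv_ge], and [inv_total] gives each ordinary cell a counterpart in [D].
    A ghost cell has seen a cell of its column pass below it, which makes [inv_ghost] strict.
    [inv_ghosts] separates the rows charged by ghost cells of one row; [inv_mono] makes it survive
    the creation of a ghost cell. *)
Record kk_inv (T : diagram) : Prop := KKInv {
  inv_mono : forall c c' s, c < c' -> bcount T c s <= bcount T c' s;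
  inv_ge : forall c s, col_ords D c s <= col_ords T c s;
  inv_total : forall c s, exists s', col_ords T c s <= col_ords D c s';
  inv_ghost : forall r c, is_ghost T (r, c) ->
    col_ords D c r.-1 < col_ords T c r.-1;
  inv_ghosts : forall r c c', is_ghost T (r, c) -> is_ghost T (r, c') ->
    c < c' -> bcount T c r.-1 < bcount T c' r.-1 }.

Lemma kk_inv_move T T' : kkohnert_move T T' -> kk_inv T -> kk_inv T'.
Proof.
move=> /kkohnert_moved [r [c [r0 [g [cm mv gP]]]]] [mono ge total gh ghs].
have /andP[r0_gt0 lt_r0r] := move_rows cm.
have oth := moved_col_ords_other mv gP.
have same := moved_col_ords cm mv gP.
(* A ghost cell of column [c] lies below row [r0] or above row [r], so the count strictly below it
   does not change. *)
have stable q c1 : is_ghost T (q, c1) -> col_ords T' c1 q.-1 = col_ords T c1 q.-1.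
  case: (eqVneq c1 c) => [->|/oth->//] /(move_no_ghost cm); rewrite same; lia.
split.
- move=> c1 c2 s lt12; rewrite /bcount; have := mono c1 c2 s lt12; rewrite /bcount.
  case: (eqVneq c2 c) => [e2|ne2].
    have ne1 : c1 != c by lia.
    by rewrite (oth _ s ne1) e2 same => /leq_trans; apply; lia.
  rewrite (oth _ s ne2); case: (eqVneq c1 c) => [e1|/oth->//].
  rewrite e1 same in lt12 *; case hs: (r0 <= s < r) => /= h0; last by lia.
  (* From row [s] to row [r], column [c] gains [r - s] ordinary cells, and column [c2], empty at row
     [r], at most [r - s - 1]. Monotonicity at row [r] is therefore strict at row [s], which leaves
     room for the new cell. *)
  have := mono c c2 r lt12; rewrite /bcount.
  rewrite (col_ords_block cm (s := s)); last by lia.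
  have -> : col_ords T c2 r = col_ords T c2 r.-1.
    rewrite -{1}(ltn_predK lt_r0r) col_ordsS (ltn_predK lt_r0r).
    have := move_right cm lt12; rewrite mem_ord_ghost negb_or.
    by case: is_ord => //; rewrite addn0.
  have : s <= r.-1 by lia.
  by move/(col_ords_bounds T c2); lia.
- move=> c1 s; have := ge c1 s.
  by case: (eqVneq c1 c) => [->|/oth->//]; rewrite same; lia.
- move=> c1 s; case: (eqVneq c1 c) => [->|/oth->//]; rewrite same.
  case hs: (r0 <= s < r); last by rewrite addn0.
  have [s' hs'] := total c r; exists s'.
  by move: hs'; rewrite (col_ords_block cm (s := s)) => [/=|]; lia.
- move=> q c1 /(moved_ghost mv) [hq|[-> ->]]; first by rewrite stable ?gh.
  by rewrite same; have := ge c r.-1; lia.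
- move=> q c1 c2 h1 h2 lt12.
  case: (moved_ghost mv h1) => [g1|[eq e1]]; last first.
    case: (moved_ghost mv h2) => [g2|[_ e2]]; last by lia.
    move: lt12; rewrite e1 => /(move_right cm).
    by rewrite -eq mem_ord_ghost g2 orbT.
  rewrite /bcount (stable _ _ g1).
  case: (moved_ghost mv h2) => [g2|[eq e2]].
    by rewrite (stable _ _ g2); apply: ghs.
  (* The new ghost cell is the right one of the two; its column has just gained an ordinary cell
     below row [r]. *)
  rewrite eq e2 same in lt12 *; have := mono c1 c r.-1 lt12; rewrite /bcount; lia.
Qed.

Lemma kk_inv_KKD T T' : KKD T T' -> kk_inv T -> kk_inv T'.
Proof. by elim=> [x y /kk_inv_move|//|x y z _ h1 _ h2 /h1 /h2]. Qed.

End Invariant.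

(** * Greedy matchings and dark clouds *)

(** [gm_max] is greediness in local form: a cell left out is blocked by a chosen cell above it or to
    its right. *)
Record greedy_matching (D K : {fset nat * nat}) : Prop := GreedyMatching {
  gm_sub : forall p : nat * nat, p \in K -> p \in D;
  gm_row : forall r c c' : nat, (r, c) \in K -> (r, c') \in K -> c = c';
  gm_col : forall r r' c : nat, (r, c) \in K -> (r', c) \in K -> r = r';
  gm_max : forall r c : nat, (r, c) \in D ->
    [\/ (r, c) \in K, exists2 k, r < k & (k, c) \in K |
        exists2 d, c < d & (r, d) \in K] }.

Lemma bigmax_attained (A : {fset nat * nat}) : A != fset0 ->
  exists2 p, p \in A & \max_(q <- A) q.2 = p.2.
Proof.
have mx (s : seq (nat * nat)) : s != [::] ->
    exists2 p, p \in s & \max_(q <- s) q.2 = p.2.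
  elim: s => // x [|y s] IHs _.
    by exists x; rewrite ?mem_head // big_seq1.
  have [//|p p_in e] := IHs _; rewrite big_cons e.
  case: (leqP x.2 p.2) => h; [exists p|exists x]; rewrite ?mem_head //.
  - by rewrite inE p_in orbT.
case/fset0Pn=> p pA; apply: mx; apply/eqP=> eA.
by have : p \in enum_fset A by []; rewrite eA.
Qed.

Lemma markableP (D : diagram) r M p :
  reflect [/\ p \in D, p.1 = r & forall k, r < k -> (k, p.2) \notin M]
          (p \in markable D r M).
Proof.
rewrite /markable !inE /=; apply: (iffP and3P) => [[pD /eqP pr /hasPn nM]|[pD pr nM]].
  split=> // k lt_rk; apply/negP=> /nM /=; rewrite eqxx pr lt_rk //.
split=> //; first exact/eqP.
apply/hasPn=> -[k d] /= kM; apply/negP=> /andP[/eqP ed lt_k].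
by move: (nM k); rewrite -ed kM -pr lt_k => /(_ isT).
Qed.

Lemma row_le_top (D : diagram) (p : nat * nat) : p \in D -> p.1 <= top_row D.
Proof. by move=> pD; apply: (leq_bigmax_seq (P := xpredT) (F := fst) p pD). Qed.

Lemma dark_clouds_greedy (D : diagram) :
  is_diagram D -> greedy_matching (domf D) (dark_clouds D).
Proof.
move=> Ddiag; rewrite /dark_clouds.
(* Generalised to the rows from [a] to [a + k - 1]: since [foldr] treats row [a] last, the induction
   adds a row at the bottom. *)
have gen k a : let M := foldr (mark_row D) fset0 (iota a k) in
    [/\ forall p : nat * nat, p \in M -> p \in D /\ a <= p.1 < a + k,
        forall r c c' : nat, (r, c) \in M -> (r, c') \in M -> c = c',
        forall r r' c : nat, (r, c) \in M -> (r', c) \in M -> r = r' &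
        forall r c : nat, (r, c) \in D -> a <= r < a + k ->
          [\/ (r, c) \in M, exists2 k, r < k & (k, c) \in M |
              exists2 d, c < d & (r, d) \in M]].
  elim: k a => [|k IHk] a /=; first by split=> // r c _; lia.
  have := IHk a.+1; set M := foldr _ _ _ => -[sub row col mx].
  have range (p : nat * nat) : p \in M -> a < p.1 < a + k.+1 by case/sub=> _; lia.
  have unmarked (c : nat) : (a, c) \in D -> (a, c) \notin markable D a M ->
      exists2 k, a < k & (k, c) \in M.
    move=> acD; rewrite /markable !inE /= acD eqxx /= negbK.
    by case/hasP=> -[k' c'] kM /= /andP[/eqP <- ?]; exists k'.
  rewrite /mark_row; case: eqP => [no|/eqP/bigmax_attained [[a' d]]].
    split=> // [p pM|r c rcD hr].
      by have [? _] := sub p pM; have h := range p pM; split=> //; lia.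
    case: (ltngtP a r) => ar; [by apply: mx => //; lia | by lia | subst a].
    by have := unmarked c rcD; rewrite no inE => /(_ isT); apply: Or32.
  case/markableP=> /= adD ea above maxd; rewrite maxd {}ea in adD above *.
  split.
  - move=> p /fset1UP[->|pM]; first by split=> //=; lia.
    by have [? _] := sub p pM; have h := range p pM; split=> //; lia.
  - move=> r c c' /fset1UP[[-> ->]|h] /fset1UP[[]|h'].
    + by move=> ->.
    + by have := range _ h'; rewrite /= ltnn.
    + by move=> er _; have := range _ h; rewrite /= er ltnn.
    + exact: row h h'.
  - move=> r r' c /fset1UP[[-> ->]|h] /fset1UP[[]|h'].
    + by move=> ->.
    + by have /andP[/= lt_r' _] := range _ h'; have := above _ lt_r'; rewrite h'.
    + move=> _ ec; have /andP[/= lt_r _] := range _ h; have := above _ lt_r.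
      by rewrite -ec h.
    + exact: col h h'.
  - move=> r c rcD hr.
    case: (ltngtP a r) => ar; [|by lia|subst r].
    + have [|h|[q lt_q h]|[e lt_e h]] := mx r c rcD; first by lia.
      * by apply: Or31; apply: fset1Ur.
      * by apply: Or32; exists q => //; apply: fset1Ur.
      * by apply: Or33; exists e => //; apply: fset1Ur.
    + case: (boolP ((a, c) \in markable D a M)) => [mac|/(unmarked _ rcD)[q lt_q h]].
        have : c <= d.
          rewrite -maxd.
          exact: (leq_bigmax_seq (P := xpredT) (F := snd) (a, c) mac isT).
        rewrite leq_eqVlt => /orP[/eqP->|lt_cd]; first by apply: Or31; apply: fset1U1.
        by apply: Or33; exists d => //; apply: fset1U1.
      by apply: Or32; exists q => //; apply: fset1Ur.
have [sub row col mx] := gen (top_row D) 1; split=> // [p /sub[]//|r c rcD].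
apply: mx => //; have /andP[/= r_gt0 _] := Ddiag _ rcD.
by have := row_le_top rcD; rewrite /=; lia.
Qed.

Definition is_matching (P : {fset nat * nat}) : Prop :=
  {in P &, injective fst} /\ {in P &, injective snd}.

Lemma is_matching_sub (P Q : {fset nat * nat}) :
  Q `<=` P -> is_matching P -> is_matching Q.
Proof.
move=> /fsubsetP sQP [inj1 inj2].
by split=> p q /sQP pP /sQP qP; [apply: inj1 | apply: inj2].
Qed.

(* The second hypothesis lets one exchange a pair (s, c), (r, d) of the matching
   for (s, d), (r, c) when (s, d) is the greedy choice in row s. *)
Lemma greedy_matching_max (D K : {fset nat * nat}) (R C : pred nat)
    (P : {fset nat * nat}) :
  greedy_matching D K ->
  (forall r s c d, r < s -> c < d ->
     (s, c) \in D -> (s, d) \in D -> (r, d) \in D -> (r, c) \in D) ->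
  (forall r s, r <= s -> R r -> R s) ->
  (forall c d, c <= d -> C c -> C d) ->
  is_matching P -> (forall p, p \in P -> [/\ p \in D, R p.1 & C p.2]) ->
  #|` P| <= #|` [fset p in K | R p.1 && C p.2]|.
Proof.
move=> [sub row col mx] exch Rup Cup.
pose Kn n := [fset p in K | R p.1 && C p.2 & p.1 < n].
(* Induction on the height [n]. The condition on the columns of [Q] ensures that no cell of [Q] is
   blocked by a chosen cell in row [n] or above. *)
suff gen n Q : is_matching Q ->
    (forall p, p \in Q -> [/\ p \in D, R p.1, C p.2, p.1 < n &
       forall k, n <= k -> (k, p.2) \notin K]) -> #|` Q| <= #|` Kn n|.
  move=> mP hP; pose n := (\max_(p <- P `|` K) p.1).+1.
  have lt_n p : p \in P `|` K -> p.1 < n.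
    by move=> h; rewrite ltnS; apply: (leq_bigmax_seq (P := xpredT) (F := fst) p h).
  apply: leq_trans (gen n P mP _) _ => [p pP|].
    have [pD Rp Cp] := hP p pP; split=> // [|k le_nk].
      by apply: lt_n; rewrite inE pP.
    apply/negP=> kK; have := lt_n (k, p.2); rewrite inE kK orbT => /(_ isT) /=.
    by rewrite ltnNge le_nk.
  by apply/fsubset_leq_card/fsubsetP=> p; rewrite !inE => /and3P[-> ->].
elim: n Q => [|n IHn] Q mQ hQ.
  case: (fset_0Vmem Q) => [->|[p /hQ[]//]]; by rewrite cardfs0.
have subK : Kn n `<=` Kn n.+1.
  apply/fsubsetP=> p; rewrite !inE => /and3P[-> -> /=]; exact: ltnW.
have [[d nd]|no] : (exists d, (n, d) \in K) \/ (forall d, (n, d) \notin K).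
  case: (boolP (has (fun p => p.1 == n) K)) => [/hasP[[k d] kd /= /eqP ek]|/hasPn no].
    by left; exists d; rewrite -ek.
  by right=> d; apply/negP=> /no; rewrite eqxx.
- have rown c : (n, c) \in Q -> c <= d.
    move=> nc; have [ncD _ _ _ above] := hQ _ nc.
    have [h|[k lt_k h]|[e lt_e h]] := mx _ _ ncD.
    + by rewrite (row _ _ _ h nd).
    + by have := above k lt_k; rewrite h.
    + by rewrite -(row _ _ _ h nd) ltnW.
  (* Dropping row [n] and column [d] costs at most two cells. One is paid for by [(n, d)] itself,
     which upward closure of [R] and [C] puts in the region. *)
  pose Q0 := [fset p in Q | (p.1 != n) && (p.2 != d)].
  have sub0 : Q0 `<=` Q by apply/fsubsetP=> p; rewrite !inE => /andP[].
  have good0 p : p \in Q0 -> [/\ p \in D, R p.1, C p.2, p.1 < n &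
      forall k, n <= k -> (k, p.2) \notin K].
    rewrite !inE => /and3P[/hQ[pD Rp Cp lt_p above] ne1 ne2]; split=> // [|k].
      by rewrite ltn_neqAle ne1.
    rewrite leq_eqVlt => /orP[/eqP<-|]; last exact: above.
    by apply/negP=> /(row _ _ _ nd) e; rewrite -e eqxx in ne2.
  have le0 : #|` Q0| <= #|` Kn n| by apply: IHn good0; apply: is_matching_sub mQ.
  have grow : R n -> C d -> #|` Kn n| < #|` Kn n.+1|.
    move=> Rn Cd; apply: fproper_ltn_card; rewrite fproperEneq subK andbT.
    apply/eqP=> e; have : (n, d) \in Kn n by rewrite e !inE /= nd Rn Cd ltnS leqnn.
    by rewrite !inE /= ltnn !andbF.
  have one p : (forall q, q \in Q -> (q.1 == n) || (q.2 == d) -> q = p) ->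
      #|` Q| <= #|` Q0|.+1.
    move=> uniqp; apply: (@leq_trans #|` p |` Q0|); last first.
      by rewrite cardfsU1 -add1n leq_add2r; case: (p \notin Q0).
    apply/fsubset_leq_card/fsubsetP=> q qQ; rewrite !inE qQ /=.
    case: (boolP ((q.1 == n) || (q.2 == d))) => [/(uniqp q qQ)->|].
      by rewrite eqxx.
    by rewrite negb_or => ->; rewrite orbT.
  case: (boolP (has (fun p => p.1 == n) Q)) => [/hasP[[n' c] nc /= /eqP en]|/hasPn non].
    subst n'; have [ncD Rn Cc _ _] := hQ _ nc.
    have Cd : C d by apply: Cup (rown _ nc) Cc.
    apply: leq_trans (grow Rn Cd).
    case: (boolP (has (fun p => (p.2 == d) && (p.1 != n)) Q)) =>
        [/hasP[[k d'] kd /= /andP[/eqP ed ne_k]]|/hasPn nod]; last first.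
      apply: leq_trans (one (n, c) _) _ => // q qQ hq; apply: mQ.1 => //=.
      by have := nod q qQ; case/orP: hq => /eqP-> //; rewrite eqxx negbK => /eqP.
    have {}ed : d' = d by []; subst d'.
    have [kdD Rk _ lt_k above] := hQ _ kd.
    have lt_kn : k < n by rewrite ltn_neqAle ne_k -ltnS.
    have ne_c : c != d.
      by apply: contra_neq ne_k => e; have [] := mQ.2 _ _ kd nc (esym e).
    (* When two cells [(n, c)] and [(k, d)] are dropped, the exchange supplies [(k, c)], which can
       be added to [Q0] before the induction hypothesis is applied. *)
    have kcD : (k, c) \in D.
      apply: exch lt_kn _ ncD (sub _ nd) kdD.
      by rewrite ltn_neqAle ne_c rown.
    have kc0 : (k, c) \notin Q0.
      rewrite !inE /=; apply/negP=> /and3P[kcQ _ _].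
      by have [e] := mQ.1 _ _ kcQ kd erefl; rewrite e eqxx in ne_c.
    have -> : Q = (n, c) |` ((k, d) |` Q0).
      apply/fsetP=> q; rewrite !inE.
      case: (boolP (q \in Q)) => qQ /=; last first.
        by rewrite orbF; apply/esym/negP=> /orP[] /eqP e; rewrite e ?nc ?kd in qQ.
      case: (eqVneq q.1 n) => [e|_]; first by rewrite (mQ.1 q (n, c) qQ nc e) eqxx.
      case: (eqVneq q.2 d) => [e|_]; last by rewrite !orbT.
      by rewrite (mQ.2 q (k, d) qQ kd e) eqxx !orbT.
    rewrite !cardfsU1 !inE /= eqxx !andbF /= xpair_eqE (gtn_eqF lt_kn) /=.
    rewrite eqxx !andbF add1n ltnS; apply: (@leq_trans #|` (k, c) |` Q0|).
      by rewrite cardfsU1 kc0.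
    have notQ0 q : q \in Q0 -> q.1 <> k /\ q.2 <> c.
      rewrite !inE => /and3P[qQ ne1 ne2]; split=> e.
        by move: ne2; rewrite (mQ.1 q (k, d) qQ kd e) eqxx.
      by move: ne1; rewrite (mQ.2 q (n, c) qQ nc e) eqxx.
    have [inj1 inj2] := is_matching_sub sub0 mQ.
    apply: IHn; first split.
    + move=> p q /fset1UP[->|p0] /fset1UP[->|q0] //= e; last exact: inj1.
        by have [[]] := notQ0 q q0.
      by have [[]] := notQ0 p p0.
    + move=> p q /fset1UP[->|p0] /fset1UP[->|q0] //= e; last exact: inj2.
        by have [_ []] := notQ0 q q0.
      by have [_ []] := notQ0 p p0.
    + move=> p /fset1UP[->|/good0//]; split=> //= q le_nq.
      have [_ _ _ _ abovec] := hQ _ nc.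
      move: le_nq; rewrite leq_eqVlt => /orP[/eqP<-|/abovec//].
      by apply/negP=> /(row _ _ _ nd) e; rewrite e eqxx in ne_c.
  case: (boolP (has (fun p => p.2 == d) Q)) => [/hasP[[k d'] kd /= /eqP ed]|/hasPn nod].
    have {}ed : d' = d by []; subst d'; have [_ Rk Cd lt_k _] := hQ _ kd.
    apply: leq_trans (grow (Rup _ _ _ Rk) Cd); last by rewrite -ltnS.
    apply: leq_trans (one (k, d) _) _ => // q qQ hq; apply: mQ.2 => //=.
    by have := non q qQ; case/orP: hq => /eqP-> //; rewrite eqxx.
  apply: leq_trans (fsubset_leq_card subK); apply: leq_trans le0.
  apply/fsubset_leq_card/fsubsetP=> q qQ.
  by rewrite !inE qQ (non q qQ) (nod q qQ).
(* With no chosen cell in row [n], a cell of [Q] there could only be blocked from above, which the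
   hypothesis on [Q] excludes. *)
- apply: leq_trans (fsubset_leq_card subK); apply: IHn => // p pQ.
  have [pD Rp Cp lt_p above] := hQ p pQ; split=> // [|k].
    move: lt_p; rewrite ltnS leq_eqVlt => /orP[/eqP ep|//].
    case: p ep pD above {pQ Rp Cp} => r c /= -> /mx[h|[k lt_k h]|[e _ h]] above.
    + by have := no c; rewrite h.
    + by have := above k lt_k; rewrite h.
    + by have := no e; rewrite h.
  by rewrite leq_eqVlt => /orP[/eqP<-|/above//].
Qed.

(** * Counting tools, and the descent of one cell *)

Lemma card_fset_count (A : {fset nat * nat}) (P : pred (nat * nat)) :
  #|` [fset p in A | P p]| = \sum_(p <- A) P p.
Proof.
rewrite -[RHS]big_mkcond /= sum1_count -size_filter; apply: perm_size.
apply: uniq_perm; rewrite ?filter_uniq ?fset_uniq // => p.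
by rewrite mem_filter !inE andbC.
Qed.

Lemma sum_interval_le lo hi n :
  \sum_(0 <= y < n) ((lo < y) && (y <= hi)) <= hi - lo.
Proof.
suff : \sum_(0 <= y < n) ((lo < y) && (y <= hi)) <= minn n.-1 hi - lo by lia.
elim: n => [|n IHn]; first by rewrite big_geq.
by rewrite big_nat_recr //=; lia.
Qed.

(** Distinct cells of [K] have distinct columns, so nothing is listed twice. This counts both the
    snowflakes and the ghost cells of an optimal diagram. *)
Lemma card_columns (K S : {fset nat * nat}) (I : nat * nat -> seq nat) :
  {in K &, injective snd} -> (forall p, uniq (I p)) ->
  S =i [seq (r, p.2) | p <- K, r <- I p] ->
  #|` S| = \sum_(p <- K) size (I p).
Proof.
move=> injK uniqI eqS.
transitivity (size [seq (r, p.2) | p <- K, r <- I p]); last first.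
  by rewrite size_allpairs_dep sumnE big_map.
apply: perm_size; apply: uniq_perm; rewrite ?fset_uniq //.
apply: allpairs_uniq_dep => //=; first exact: fset_uniq.
move=> _ _ /allpairsPdep[p [r [pK _ ->]]] /allpairsPdep[q [s [qK _ ->]]] /=.
by case=> -> epq; rewrite (injK _ _ pK qK epq).
Qed.

(** Every move goes down by one row, so nothing is jumped over; [g] selects ghost moves. Row [a] may
    hold cells to the right, because the cell stops there. *)
Lemma run_down (T : diagram) (c a s : nat) (g : bool) : 0 < a <= s ->
  is_ord T (s, c) -> (forall q, a <= q < s -> (q, c) \notin T) ->
  (forall q c', a < q <= s -> c < c' -> (q, c') \notin T) ->
  exists2 T', KKD T T' & forall q d, T'.[? (q, d)] =
    if (d == c) && (a <= q <= s)
    then if q == a then Some Ordinary else if g then Some Ghost else None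
    else T.[? (q, d)].
Proof.
case/andP=> a_gt0 /subnKC <-; elim: (s - a) T => [|k IHk] T.
  rewrite addn0 => oT _ _; exists T => [|q d]; first exact: rt_refl.
  case: eqVneq => //= ->; case: (ltngtP q a) => //= ->.
  by move: oT; rewrite /is_ord; case: T.[? _] => [[]|].
rewrite addnS => oT empty right.
have cm : can_move T (a + k).+1 c (a + k).
  split.
  - split=> [|c']; first by rewrite mem_ord_ghost oT.
    by apply: contraTT; rewrite -ltnNge => /right; apply; lia.
  - exact: ord_not_ghost.
  - by split=> [||q]; [lia | apply: empty; lia | lia].
  - by move=> q; lia.
pose x := (a + k).+1; pose gx := if g then Some Ghost else None.
have [T1 kT1 mv] : exists2 T1, kkohnert_move T T1 & moved T x c (a + k) gx T1.
  rewrite /gx; case: (g); [exists (T.[(x, c) <- Ghost].[(a + k, c) <- Ordinary])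
    | exists (T.[~ (x, c)].[(a + k, c) <- Ordinary])];
    [exact: Ghost_move | | exact: Kohnert_move | ] => p;
    by rewrite !fnd_set ?fnd_rem1; do 2!case: (p == _).
have notin1 (q d : nat) : (q, d) \notin T -> q < a + k \/ c < d -> (q, d) \notin T1.
  move=> nT hq; rewrite -fndSome mv !xpair_eqE.
  have -> : (q == a + k) && (d == c) = false by lia.
  have -> : (q == x) && (d == c) = false by rewrite /x; lia.
  by rewrite fndSome.
have [|q hq|q c' hq lt_c|T' kT' hT'] := IHk T1.
- by rewrite /is_ord mv eqxx.
- by apply: notin1; [apply: empty; lia | left; lia].
- by apply: notin1; [apply: right => //; lia | right].
exists T' => [|q d]; first by apply: rt_trans kT'; apply: rt_step.
rewrite hT' mv !xpair_eqE /x /gx.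
case: (eqVneq d c) => //= _; rewrite ?andbT ?andbF //=.
case: (ltngtP q (a + k).+1) => [lt_q|lt_q|->].
- have -> : (q <= a + k) = true by lia.
  case: (leqP a q) => //= lt_qa; first by case: eqP => //; lia.
- have -> : (q <= a + k) = false by lia.
  by rewrite !andbF; case: eqP => //; lia.
- have -> : ((a + k).+1 <= a + k) = false by lia.
  rewrite andbF andbT; case: eqP => [|_]; first by lia.
  have -> : a <= (a + k).+1 by lia.
  by case: eqP => //; lia.
Qed.

(** * Geometry of generalized skew diagrams *)

Section Skew.
Variable D : diagram.
Hypothesis hD : generalized_skew D.

Let L := top_row D.

Lemma skew_is_diagram : is_diagram D.
Proof. by case: hD. Qed.

Lemma skew_ghost_free p : ~~ is_ghost D p.
Proof. by case: hD => _ gf _ _ _. Qed.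

Lemma skew_ord p : is_ord D p = (p \in D).
Proof. by rewrite mem_ord_ghost (negPf (skew_ghost_free p)) orbF. Qed.

Lemma rightmost_exists r b : (r, b) \in D -> exists2 h, rightmost D r h & b <= h.
Proof.
move=> rb; have ex : exists c, (r, c) \in D by exists b.
have ub c : (r, c) \in D -> c <= \max_(p <- domf D) p.2.
  move=> h; exact: (leq_bigmax_seq (P := xpredT) (F := snd) (r, c) h).
by case: (ex_maxnP ex ub) => h rh hmax; exists h; [split | apply: hmax].
Qed.

Lemma leftmost_exists r b : (r, b) \in D -> exists2 l, leftmost D r l & l <= b.
Proof.
move=> rb; have ex : exists c, (r, c) \in D by exists b.
by case: (ex_minnP ex) => l rl lmin; exists l; [split | apply: lmin].
Qed.

Lemma skew_convex r a b c :
  (r, a) \in D -> (r, b) \in D -> a <= c <= b -> (r, c) \in D.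
Proof.
move=> /leftmost_exists[l ll le_la] /rightmost_exists[h rh le_bh] hc.
case: (ltngtP c l) => [|lt_lc|->]; [by lia | | by case: ll].
case: (ltngtP c h) => [lt_ch||->]; [ | by lia | by case: rh].
by case: hD => _ _ conv _ _; apply: conv ll rh _; rewrite lt_lc.
Qed.

(** By monotonicity of the row ends, row [r] starts no later than column [a] and row [s] ends no
    earlier than column [b]; convexity of the rows does the rest. *)
Lemma skew_corners r s a b : r < s -> (r, b) \in D -> (s, a) \in D -> a <= b ->
  (r, a) \in D /\ (s, b) \in D.
Proof.
move=> lt_rs rb sa le_ab; case: hD => _ _ _ right left; split.
  have [l ll le_l] := leftmost_exists rb; have [l' ll' le_l'] := leftmost_exists sa.
  have le_ll' := left _ _ _ _ lt_rs ll ll'.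
  by apply: (@skew_convex _ l b) => //; [case: ll | lia].
have [h rh le_h] := rightmost_exists rb; have [h' rh' le_h'] := rightmost_exists sa.
have le_hh' := right _ _ _ _ lt_rs rh rh'.
by apply: (@skew_convex _ a h') => //; [case: rh' | lia].
Qed.

Definition row_occ r := has (fun p : nat * nat => p.1 == r) (domf D).
Definition row_lt r c :=
  all (fun p : nat * nat => (p.1 == r) ==> (p.2 < c)) (domf D).

Lemma row_occP r : reflect (exists c, (r, c) \in D) (row_occ r).
Proof.
apply: (iffP hasP) => [[[k c] kc /= /eqP<-]|[c rc]]; first by exists c.
by exists (r, c).
Qed.

Lemma row_ltP r c : reflect (forall c', (r, c') \in D -> c' < c) (row_lt r c).
Proof.
apply: (iffP allP) => [h c' /h /=|h [k c'] /= kc]; first by rewrite eqxx.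
by apply/implyP=> /eqP ek; apply: h; rewrite -ek.
Qed.

Definition row_index s := \sum_(1 <= r < s.+1) row_occ r.
Definition rows_left c := \sum_(1 <= r < L.+1) (row_occ r && row_lt r c).

Lemma row_le_topS r c : (r, c) \in D -> 0 < r < L.+1.
Proof.
move=> rc; rewrite ltnS (row_le_top rc) andbT.
by have /andP[] := skew_is_diagram rc.
Qed.

Lemma sum_rows_widen (P : pred nat) s : (forall r, P r -> r <= L) ->
  \sum_(1 <= r < s.+1) P r = \sum_(1 <= r < L.+1) ((r <= s) && P r).
Proof.
move=> leP; case: (leqP s L) => h.
  rewrite (big_nat_widen _ _ L.+1) // big_mkcond /=; apply: eq_bigr => r _.
  by rewrite ltnS; case: (r <= s).
rewrite [RHS](big_nat_widen _ _ s.+1) ?ltnS 1?ltnW // [RHS]big_mkcond /=.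
apply: eq_big_nat => r /andP[_]; rewrite !ltnS => -> /=.
by case: leqP => //; case hP: (P r) => //; have := leP r hP; lia.
Qed.

Lemma skew_col_ords c s :
  col_ords D c s = \sum_(1 <= r < L.+1) ((r <= s) && ((r, c) \in D)).
Proof.
rewrite -sum_rows_widen => [|r /row_le_top//].
by apply: eq_bigr => r _; rewrite skew_ord.
Qed.

(** True row by row: by convexity, a row with a cell in column [c] either meets column [c'] or lies
    wholly to its left. *)
Lemma skew_bcount_mono c c' s : c < c' ->
  bcount rows_left D c s <= bcount rows_left D c' s.
Proof.
move=> lt_cc'; rewrite /bcount !skew_col_ords /rows_left -!big_split /=.
apply: leq_sum => r _.
case: (row_ltP r c) => [lt_c|_].
  have -> : row_lt r c' by apply/row_ltP=> e /lt_c /ltn_trans; apply.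
  have /negPf-> : (r, c) \notin D by apply/negP=> /lt_c; rewrite ltnn.
  by rewrite andbF addn0 leq_addr.
rewrite andbF add0n; case: (boolP ((r, c) \in D)) => [rc|]; last by rewrite andbF.
have -> /= : row_occ r by apply/row_occP; exists c.
case: (row_ltP r c') => [_|nlt]; first by case: (r <= s).
suff -> : (r, c') \in D by [].
case: (boolP ((r, c') \in D)) => // nc'; case: nlt => e re; rewrite ltnNge.
by apply: contra nc' => le_c'e; apply: skew_convex rc re _; rewrite ltnW.
Qed.

(** By [skew_corners], a nonempty row below row [r] meets column [c] or lies wholly to its left, and
    no row above row [r] lies wholly to its left. *)
Lemma row_indexE r c : (r, c) \in D ->
  row_index r = rows_left c + col_ords D c r.
Proof.
move=> rc; rewrite /row_index sum_rows_widen => [|k /row_occP[e /row_le_top]//].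
rewrite skew_col_ords /rows_left -big_split /=; apply: eq_bigr => k _.
case: (row_ltP k c) => [lt_c|nlt].
  have /negPf-> : (k, c) \notin D by apply/negP=> /lt_c; rewrite ltnn.
  rewrite !andbT andbF addn0; case: row_occP => [[e ke]|_]; last by rewrite andbF.
  case: leqP => // lt_rk.
  have [] := skew_corners lt_rk rc ke; first exact/ltnW/lt_c.
  by move=> _ /lt_c; rewrite ltnn.
rewrite andbF add0n; case: ltngtP => //= [lt_kr|->]; last first.
  by rewrite rc; case: row_occP => // -[]; exists c.
congr nat_of_bool; apply/row_occP/idP => [[e ke]|kc]; last by exists c.
case: (boolP ((k, c) \in D)) => // nkc; case: nlt => e' ke'; rewrite ltnNge.
by apply: contra nkc => le_ce'; have [] := skew_corners lt_kr ke' rc le_ce'.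
Qed.

(** * Snowflake count and upper bound *)

Let K := dark_clouds D.

Let greedyK : greedy_matching (domf D) K.
Proof. exact: dark_clouds_greedy skew_is_diagram. Qed.

Let colK : {in K &, injective snd}.
Proof.
move=> [r c] [s d] rc sd /= ecd; rewrite {}ecd in rc *.
by rewrite (gm_col greedyK rc sd).
Qed.

Lemma count_empty (c s : nat) :
  count (fun r : nat => (r, c) \notin D) (iota 1 s) + col_ords D c s = s.
Proof.
elim: s => [|s IHs]; first by rewrite col_ords0.
rewrite -{1}(addn1 s) iotaD count_cat /= add1n col_ordsS skew_ord.
by move: IHs; set n := count _ _; case: ((s.+1, c) \in D) => /=; lia.
Qed.

(** Each difference counts the empty positions below a dark cloud; the cloud itself occurs in both
    terms and cancels. *)
Lemma sf_sum : sf D = \sum_(p <- K) (p.1 - col_ords D p.2 p.1).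
Proof.
rewrite /sf.
rewrite (@card_columns K (snowflakes D) (fun p : nat * nat =>
  [seq r : nat <- iota 1 p.1.-1 | (r, p.2) \notin D])).
- apply: eq_big_seq => /= -[r c] /(gm_sub greedyK) rc /=.
  have /andP[r_gt0 _] := row_le_topS rc; rewrite size_filter.
  have := count_empty c r.-1.
  have := col_ordsS D c r.-1; rewrite prednK // skew_ord rc /=; lia.
- exact: colK.
- by move=> p; rewrite filter_uniq ?iota_uniq.
- move=> q; rewrite !inE /=; apply/andP/allpairsPdep => /=.
    case=> /allpairsPdep[p [r [pK rI ->]]] nD; exists p, r.
    by rewrite mem_filter nD.
  case=> p [r [pK]]; rewrite mem_filter => /andP[nD rI] ->; split=> //.
  by apply/allpairsPdep; exists p, r.
Qed.

Lemma kk_inv_skew : kk_inv D rows_left D.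
Proof.
have nog p : is_ghost D p = false by apply/negbTE/skew_ghost_free.
by split=> // [c c' s|c s|r c|r c c']; rewrite ?nog //;
  [apply: skew_bcount_mono | exists s].
Qed.

Lemma col_ords_hit (c s m : nat) : 0 < m <= col_ords D c s ->
  exists2 r, (r, c) \in D & col_ords D c r = m.
Proof.
elim: s => [|s IHs]; first by rewrite col_ords0; lia.
case: (leqP m (col_ords D c s)) => [le_m /andP[m_gt0 _]|lt_m].
  by apply: IHs; rewrite m_gt0.
have := col_ordsS D c s; case: (boolP (is_ord D (s.+1, c))) => [oD eD le_m|_ eD].
  by exists s.+1; rewrite -?skew_ord //; lia.
by lia.
Qed.

Lemma num_ghosts_le_sf T : KKD D T -> num_ghosts T <= sf D.
Proof.
move=> /kk_inv_KKD/(_ kk_inv_skew) [mono ge total gh ghs].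
pose G : {fset nat * nat} := [fset p in domf T | is_ghost T p].
have GP (p : nat * nat) : p \in G -> is_ghost T p by rewrite !inE => /andP[].
pose here (g : nat * nat) r :=
  ((r, g.2) \in D) && (col_ords D g.2 r == col_ords T g.2 g.1.-1).
(* The row of the charged cell of [D]; the default 0 is never reached for a ghost cell, by
   [inv_ghost], [inv_total] and [col_ords_hit]. *)
pose src g := head 0 [seq r <- iota 0 L.+1 | here g r].
have srcP (g : nat * nat) : g \in G ->
    [/\ (src g, g.2) \in D, col_ords D g.2 (src g) = col_ords T g.2 g.1.-1 &
        g.1 <= src g].
  case: g => r c /GP gh_rc; have lt_rc := gh r c gh_rc.
  have : here (r, c) (src (r, c)).
    rewrite /src; have [s le_s] := total c r.-1.
    have [|q qD eq_q] := @col_ords_hit c s (col_ords T c r.-1); first by lia.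
    have : q \in [seq r0 <- iota 0 L.+1 | here (r, c) r0].
      by rewrite mem_filter mem_iota /= /here qD eq_q eqxx ltnS (row_le_top qD).
    case E: [seq _ <- _ | _] => [|x l] // _.
    have : x \in [seq r0 <- iota 0 L.+1 | here (r, c) r0] by rewrite E mem_head.
    by rewrite mem_filter => /andP[].
  case/andP=> /= sD /eqP es; split=> //.
  case: (leqP r (src (r, c))) => // lt_src.
  have le_src : src (r, c) <= r.-1 by lia.
  by have := col_ords_bounds D c le_src; lia.
(* The level of a ghost cell, shifted by [L] to stay in [nat]. *)
pose y (g : nat * nat) := g.1 + L - row_index (src g).
have idx_le s : row_index s <= s.
  elim: s => [|s IHs]; first by rewrite /row_index big_geq.
  by rewrite /row_index big_nat_recr //= -/(row_index s); case: row_occ; lia.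
have idx_lip r s : r <= s -> row_index s <= row_index r + (s - r).
  move=> le_rs; rewrite -{1}(subnKC le_rs); elim: (s - r) => [|k IHk].
    by rewrite !addn0.
  by rewrite addnS {1}/row_index big_nat_recr //= -/(row_index _); case: row_occ; lia.
have idxE (g : nat * nat) : g \in G -> row_index (src g) = bcount rows_left T g.2 g.1.-1.
  by case/srcP=> sD es _; rewrite (row_indexE sD) es.
(* The region of level [z]: [RR] expresses that the charged row is not below the ghost cell, [CC]
   that fewer than [g.1] ordinary cells lie below a ghost cell [g]. *)
pose RR z r := z + row_index r <= r + L.
pose CC z c := L < z + rows_left c.
have main z : #|` [fset g in G | y g == z]| <=
    \sum_(p <- K) (RR z p.1 && CC z p.2).
  rewrite -card_fset_count.
  set Gz := [fset g in G | y g == z].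
  pose f (g : nat * nat) := (src g, g.2).
  have GzP (g : nat * nat) : g \in Gz -> g \in G /\ y g = z.
    by rewrite !inE => /andP[? /eqP].
  have le_idx (g : nat * nat) : g \in G -> row_index (src g) <= L.
    by case/srcP=> sD _ _; apply: leq_trans (idx_le _) (row_le_top sD).
  (* Equal levels and equal charged rows put both ghost cells in one row, where [inv_ghosts]
     separates their indices. *)
  have same_row (g h : nat * nat) : g \in Gz -> h \in Gz -> src g = src h ->
      ~~ (g.2 < h.2).
    move=> /GzP[gG yg] /GzP[hG yh] e; apply/negP=> lt_gh.
    have eq1 : g.1 = h.1.
      have := le_idx _ gG; have := le_idx _ hG; move: yg yh; rewrite /y e; lia.
    have := idxE _ gG; have := idxE _ hG; rewrite e => ->.
    have := ghs g.1 g.2 h.2; rewrite {2}eq1 -!surjective_pairing.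
    move=> /(_ (GP _ gG) (GP _ hG) lt_gh); rewrite eq1; lia.
  have G_gt0 (g : nat * nat) : g \in G -> 0 < g.1.
    case: g => -[|r] c //= /GP /gh; rewrite !col_ords0 ltnn //.
  (* From [g] up to [h] the index grows by less than the height, because [g] is not an ordinary
     cell; so the level increases. *)
  have same_col (g h : nat * nat) : g \in Gz -> h \in Gz -> g.2 = h.2 ->
      ~~ (g.1 < h.1).
    move=> /GzP[gG yg] /GzP[hG yh] e; apply/negP=> lt_gh.
    have := idxE _ gG; have := idxE _ hG; rewrite /bcount -e => eh eg.
    have := le_idx _ gG; have := le_idx _ hG; have := G_gt0 _ gG.
    have le_g : g.1 <= h.1.-1 by lia.
    have /andP[_] := col_ords_bounds T g.2 le_g.
    have := col_ordsS T g.2 g.1.-1; rewrite prednK ?G_gt0 // -surjective_pairing.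
    have := @ord_not_ghost T g; rewrite (GP _ gG); case: is_ord => [/(_ isT)//|_].
    move: yg yh; rewrite /y; lia.
  have col_inj (g h : nat * nat) : g \in Gz -> h \in Gz -> g.2 = h.2 -> g = h.
    move=> gG hG e; have := same_col _ _ gG hG e; have := same_col _ _ hG gG (esym e).
    rewrite [g]surjective_pairing [h]surjective_pairing e /=.
    by case: ltngtP => // ->.
  have row_inj (g h : nat * nat) :
      g \in Gz -> h \in Gz -> src g = src h -> g.2 = h.2.
    move=> gG hG e; have := same_row _ _ gG hG e; have := same_row _ _ hG gG (esym e).
    by case: ltngtP.
  have regionP (g : nat * nat) :
      g \in Gz -> [/\ f g \in domf D, RR z (f g).1 & CC z (f g).2].
    move=> /GzP[gG yg]; have [sD _ le_g] := srcP _ gG; have := le_idx _ gG.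
    have := idxE _ gG; have := G_gt0 _ gG.
    have /andP[_] := col_ords_bounds T g.2 (leq0n g.1.-1).
    by rewrite col_ords0 /bcount /RR /CC -yg /y /= => *; split=> //; lia.
  have <- : #|` f @` Gz| = #|` Gz|.
    by apply: card_in_imfset => g h gG hG [_ /col_inj]; apply.
  apply: (@greedy_matching_max (domf D)) greedyK _ _ _ _ _.
  - move=> r s c d lt_rs lt_cd sc _ rd.
    by have [] := skew_corners lt_rs rd sc (ltnW lt_cd).
  - by move=> r s le_rs; rewrite /RR; have := idx_lip _ _ le_rs; lia.
  - move=> c d le_cd; rewrite /CC => /leq_trans; apply; rewrite leq_add2l.
    apply: leq_sum => r _; case: row_occ => //=; case: (row_ltP r c) => // lt_c.
    have -> // : row_lt r d by apply/row_ltP=> e /lt_c lt_ec; apply: leq_trans le_cd.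
  - split=> _ _ /imfsetP[g /= gG ->] /imfsetP[h /= hG ->] /= e.
      by rewrite /f e (row_inj _ _ gG hG e).
    by rewrite (col_inj _ _ gG hG e).
  - by move=> _ /imfsetP[g /= gG ->]; apply: regionP.
have lt_y (g : nat * nat) : g \in G -> y g < (L + L).+1.
  by case/srcP=> /row_le_top /= h _ le_g; rewrite /y /L; lia.
(* A dark cloud lies in the region for the levels [z] with [L - rows_left c < z <= r + L - row_index
   r]; by [row_indexE], these are as many as its snowflakes. *)
have sum_region (r c : nat) : (r, c) \in D ->
    \sum_(0 <= z < (L + L).+1) (RR z r && CC z c) <= r - col_ords D c r.
  move=> rc; have eidx := row_indexE rc.
  have le_r := idx_le r; have le_L : r <= L := row_le_top rc.
  have -> : r - col_ords D c r = r + L - row_index r - (L - rows_left c) by lia.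
  apply: leq_trans (sum_interval_le _ _ (L + L).+1).
  by apply: leq_sum => z _; rewrite /RR /CC; lia.
rewrite sf_sum; apply: (@leq_trans (\sum_(0 <= z < (L + L).+1)
    \sum_(p <- K) (RR z p.1 && CC z p.2))); last first.
  rewrite exchange_big /= big_seq [leqRHS]big_seq.
  by apply: leq_sum => -[r c] /(gm_sub greedyK)/sum_region.
apply: leq_trans; last by apply: leq_sum => z _; apply: main.
under eq_bigr do rewrite card_fset_count.
rewrite exchange_big /= /num_ghosts -/G -sum1_size big_seq [leqRHS]big_seq.
apply: leq_sum => g gG.
by rewrite (bigD1_seq (y g)) ?iota_uniq ?mem_index_iota ?lt_y //= eqxx.
Qed.

(** * Lower bound *)

(** Otherwise [skew_corners] gives a cell [(s, c)] to the right of the cloud [(s, d)], with no dark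
    cloud above it, and the greedy choice in row [s] would not have been [d]. *)
Lemma dark_cloud_cols r s c d : (r, c) \in K -> (s, d) \in K -> r < s -> c < d.
Proof.
move=> rc sd lt_rs; case: (ltngtP c d) => // [lt_dc|ecd]; last first.
  by rewrite ecd in rc; move: lt_rs; rewrite (gm_col greedyK rc sd) ltnn.
have [_ sc] := skew_corners lt_rs (gm_sub greedyK rc) (gm_sub greedyK sd) (ltnW lt_dc).
have [h|[k lt_k h]|[e lt_e h]] := gm_max greedyK sc.
- by move: lt_dc; rewrite (gm_row greedyK h sd) ltnn.
- by move: lt_rs; rewrite (gm_col greedyK rc h); lia.
- by move: lt_e; rewrite (gm_row greedyK h sd); lia.
Qed.

Lemma dark_cloud_pos r c : (r, c) \in K -> 0 < r.
Proof. by move=> /(gm_sub greedyK)/row_le_topS/andP[]. Qed.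

(* The junk value 0 stands for a column without a dark cloud. *)
Definition dark_row (c : nat) : nat := \max_(p <- K | p.2 == c) p.1.

Lemma dark_rowP (k c : nat) : (k, c) \in K -> dark_row c = k.
Proof.
move=> kc; apply/eqP; rewrite eqn_leq; apply/andP; split.
  apply/bigmax_leqP_seq => -[r d] rd /= /eqP ed; rewrite {}ed in rd.
  by rewrite (gm_col greedyK rd kc).
exact: (leq_bigmax_seq (P := fun p => p.2 == c) (F := fst) (k, c) kc (eqxx c)).
Qed.

Lemma dark_row_mem c : 0 < dark_row c -> (dark_row c, c) \in K.
Proof.
case: (boolP (has (fun p : nat * nat => p.2 == c) K)) => [/hasP|no].
  by case=> -[k d] kd /= /eqP ed; rewrite ed in kd; rewrite (dark_rowP kd).
by rewrite /dark_row big_hasC.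
Qed.

(** This bounds the height of the sunk cells to the right of the cell that is about to descend. *)
Lemma skew_col_ords_anti c d s : c < d -> (s, c) \in D ->
  col_ords D d s <= col_ords D c s.
Proof.
move=> lt_cd sc; rewrite !skew_col_ords; apply: leq_sum => r _.
case: (ltngtP r s) => //= [lt_rs|->]; last by rewrite sc leq_b1.
case: (boolP ((r, d) \in D)) => // rd.
by have [-> _] := skew_corners lt_rs rd sc (ltnW lt_cd).
Qed.

(* Column [c] once the cells of the rows up to [n] are processed: those below
   the dark cloud are at the bottom, and the dark cloud, if its row is among
   these, has left a ghost cell at each step of its way down. *)
Definition stage (n c r : nat) : option cell :=
  let m := minn (dark_row c) n in
  if r <= m then
    if 0 < r <= col_ords D c m then Some Ordinary
    else if (dark_row c <= n) && (0 < r) then Some Ghost else None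
  else D.[? (r, c)].

Lemma stage_column (T : diagram) (n j : nat) :
  (forall r c : nat, T.[? (r, c)] = stage (if c <= j then n else n.+1) c r) ->
  exists2 T', KKD T T' &
    forall r c, T'.[? (r, c)] = stage (if c < j then n else n.+1) c r.
Proof.
move=> hT.
have trivial_case : (forall r, stage n j r = stage n.+1 j r) ->
    exists2 T', KKD T T' &
      forall r c, T'.[? (r, c)] = stage (if c < j then n else n.+1) c r.
  move=> e; exists T => [|r c]; first exact: rt_refl.
  by rewrite hT; case: ltngtP => // ->.
(* Here column [j] has no dark cloud ([dark_row j = 0]) or has it below row [n + 1]: the cell, if
   any, stays. *)
case: (leqP (dark_row j) n) => [le_n|lt_n].
  apply: trivial_case => r; rewrite /stage.
  by rewrite (minn_idPl le_n) (minn_idPl (leqW le_n)) le_n (leqW le_n).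
have colS := col_ordsS D j n; have jK := dark_row_mem (leq_ltn_trans (leq0n n) lt_n).
case: (boolP ((n.+1, j) \in D)) => [njD|njD]; last first.
  apply: trivial_case => r; rewrite /stage.
  have lt_n1 : n.+1 < dark_row j.
    rewrite ltn_neqAle lt_n andbT; apply: contra njD => /eqP->.
    exact: (gm_sub greedyK).
  rewrite (minn_idPr (ltnW lt_n)) (minn_idPr (ltnW lt_n1)).
  rewrite colS skew_ord (negPf njD) addn0.
  have [-> ->] : (dark_row j <= n) = false /\ (dark_row j <= n.+1) = false by lia.
  case: (ltngtP n.+1 r) => [lt_r|lt_r|<-]; rewrite ?ltnn.
  - by have -> : (r <= n) = false by lia.
  - by have -> : r <= n by lia.
  - rewrite not_fnd //=; case: leqP => // h.
    by have /andP[_] := col_ords_bounds D j (leq0n n); rewrite col_ords0; lia.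
rewrite skew_ord njD addn1 in colS.
have /andP[_] := col_ords_bounds D j (leq0n n); rewrite col_ords0 add0n subn0 => le_col.
have empty q : (col_ords D j n).+1 <= q < n.+1 -> (q, j) \notin T.
  move=> hq; rewrite -fndSome hT leqnn /stage (minn_idPr (ltnW lt_n)).
  have -> : q <= n by lia.
  have -> : q <= col_ords D j n = false by lia.
  by rewrite andbF leqNgt lt_n.
(* Without a dark cloud in column [c'], a cell there would have one to its right in row [q], against
   [dark_cloud_cols]. With one, it is above that of column [j], and the cells sunk in column [c']
   reach at most the landing row. *)
have right q c' : (col_ords D j n).+1 < q <= n.+1 -> j < c' -> (q, c') \notin T.
  move=> hq lt_j; rewrite -fndSome hT leqNgt lt_j /stage /=.
  case: (posnP (dark_row c')) => [e0|gt0].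
    rewrite e0 min0n leqNgt; have -> /= : 0 < q by lia.
    rewrite fndSome; apply/negP=> /(gm_max greedyK)[h|[k _ h]|[d lt_d h]].
    + by have := dark_rowP h; lia.
    + by have h' := dark_rowP h; have := dark_cloud_pos h; lia.
    + case: (ltngtP q (dark_row j)) => [lt_q|lt_q|eq_q]; last 1 first.
      * by rewrite -eq_q in jK; have := gm_row greedyK h jK; lia.
      * by have := dark_cloud_cols h jK lt_q; lia.
      * by lia.
  have c'K := dark_row_mem gt0.
  case: (ltngtP (dark_row c') (dark_row j)) => [lt_dark|lt_dark|e].
  - by have := dark_cloud_cols c'K jK lt_dark; lia.
  - rewrite (minn_idPr _); last by lia.
    have := skew_col_ords_anti lt_j njD; rewrite colS => le_c'.
    have -> : q <= n.+1 by lia.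
    have -> : q <= col_ords D c' n.+1 = false by lia.
    have -> : dark_row c' <= n.+1 = false by lia.
    by rewrite andbF.
  - by rewrite e in c'K; have := gm_row greedyK c'K jK; lia.
have oT : is_ord T (n.+1, j).
  rewrite /is_ord hT leqnn /stage (minn_idPr (ltnW lt_n)) ltnn.
  by have := skew_ord (n.+1, j); rewrite /is_ord njD.
(* Ghost moves are used exactly when the cell is the dark cloud of its column. *)
have [|T' kT' hT'] := run_down (dark_row j == n.+1) _ oT empty right.
  by rewrite ltnS.
exists T' => // r c; rewrite hT' hT.
case: (ltngtP c j) => //= ecj; subst c; rewrite /stage.
rewrite (minn_idPr (ltnW lt_n)) (minn_idPr lt_n) colS.
have -> : (dark_row j <= n.+1) = (dark_row j == n.+1) by lia.
have -> : (dark_row j <= n) = false by lia.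
case: (ltngtP r (col_ords D j n).+1) => [lt_r|lt_r|->] /=.
- have [-> ->] : r <= n /\ r <= n.+1 by lia.
  have -> : r <= col_ords D j n by lia.
  by case: (r) => //=; rewrite andbF.
- have -> : 0 < r by lia.
  rewrite andbT; case: (leqP r n.+1) => [//|lt_nr].
  by have -> : r <= n = false by lia.
- by rewrite ltnS le_col.
Qed.

Lemma stage_row (T : diagram) (n : nat) : (forall r c, T.[? (r, c)] = stage n c r) ->
  exists2 T', KKD T T' & forall r c, T'.[? (r, c)] = stage n.+1 c r.
Proof.
move=> hT; pose W := \max_(p <- domf D) p.2.
have far r c : W < c -> stage n c r = stage n.+1 c r.
  move=> lt_c; have e0 : dark_row c = 0.
    apply/eqP; rewrite -leqn0 leqNgt; apply/negP=> /dark_row_mem /(gm_sub greedyK) h.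
    have := @leq_bigmax_seq _ _ xpredT snd (dark_row c, c) h isT.
    by rewrite -/W /=; lia.
  by rewrite /stage e0 !min0n.
(* The last [j] of the columns from 0 to [W] are done; [j = W + 1] exhausts them. *)
have step j : exists2 T', KKD T T' &
    forall r c, T'.[? (r, c)] = stage (if c + j <= W then n else n.+1) c r.
  elim: j => [|j [T1 k1 h1]].
    exists T => [|r c]; first exact: rt_refl.
    by rewrite addn0 hT; case: leqP => // /far.
  case: (leqP j W) => [le_j|lt_j]; last first.
    exists T1 => // r c; rewrite h1.
    by have [-> ->] : c + j <= W = false /\ c + j.+1 <= W = false by lia.
  have [|T2 k2 h2] := @stage_column T1 n (W - j).
    by move=> r c; rewrite h1 leq_subRL // addnC.
  exists T2 => [|r c]; first exact: rt_trans k1 k2.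
  by rewrite h2 ltn_subRL addnC addnS.
have [T' k' h'] := step W.+1; exists T' => // r c; rewrite h'.
by have -> : c + W.+1 <= W = false by lia.
Qed.

Lemma num_ghosts_sf : exists2 T, KKD D T & num_ghosts T = sf D.
Proof.
have all_rows n : exists2 T, KKD D T & forall r c, T.[? (r, c)] = stage n c r.
  elim: n => [|n [T kT /stage_row[T' kT' hT']]].
    exists D => [|r c]; first exact: rt_refl.
    rewrite /stage minn0 leqn0; case: eqP => [->|//].
    by rewrite andbF not_fnd //; apply/negP=> /row_le_topS.
  by exists T' => //; apply: rt_trans kT kT'.
have [T kT hT] := all_rows L; exists T => //.
rewrite sf_sum /num_ghosts; set G := [fset _ in _ | _].
(* The ghost cells fill the column from just above the sunk cells up to the row of the dark cloud:
   not the snowflake positions in general, but equally many. *)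
rewrite (@card_columns K G (fun p : nat * nat =>
  iota (col_ords D p.2 p.1).+1 (p.1 - col_ords D p.2 p.1))).
- by apply: eq_bigr => p _; rewrite size_iota.
- exact: colK.
- by move=> p; apply: iota_uniq.
- move=> [r c]; rewrite !inE /=.
  have -> : ((r, c) \in T) && is_ghost T (r, c) = is_ghost T (r, c).
    by rewrite mem_ord_ghost; case: is_ghost; rewrite ?orbT ?andbF.
  rewrite /is_ghost hT /stage.
  have le_dark : dark_row c <= L.
    case: (posnP (dark_row c)) => [->//|/dark_row_mem/(gm_sub greedyK)].
    exact: row_le_top.
  rewrite (minn_idPl le_dark) le_dark /=.
  apply/idP/allpairsPdep => /= [|[[k d] [q [kd]]]].
    case: (leqP r (dark_row c)) => [le_r|_]; last first.
      by rewrite -/(is_ghost D (r, c)) (negPf (skew_ghost_free _)).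
    case: (posnP r) => [//|r_gt0] /=; case: leqP => //= lt_r _.
    exists (dark_row c, c), r; split=> //.
      by apply: dark_row_mem; apply: leq_trans le_r.
    by rewrite mem_iota /=; lia.
  rewrite mem_iota /= => hq [-> ->]; rewrite (dark_rowP kd).
  have -> : q <= k by lia.
  have -> : q <= col_ords D d k = false by lia.
  by have -> : 0 < q by lia.
Qed.

End Skew.

Theorem theorem3p7 (D : diagram) (hD : generalized_skew D) :
  is_MaxG D (sf D).
Proof. by split; [apply: num_ghosts_sf | apply: num_ghosts_le_sf]. Qed.
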